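(* Let $A\in\mathbb{C}^{n\times n}$ be positive definite with eigenvalues $\lambda_1\geq\lambda_2\geq\ldots\geq\lambda_n>0$, and let $D\in\mathbb{C}^{m\times m}$ be a Hermitian matrix with eigenvalues $\mu_1\leq\mu_2\leq\ldots\leq\mu_r\leq 0<\mu_{r+1}\leq\ldots\leq\mu_m$ (in both cases counted with multiplicities). Then there exists $K\in\mathbb{C}^{n\times m}$ with $\|K\|<1$ such that $$S=\begin{bmatrix}A&-AK\\ K^*A&D\end{bmatrix}$$ is a $J$-frame matrix if and only if $$r\leq n\quad\text{and}\quad \lambda_i+\mu_i>0\ \text{ for } i=1,\ldots,r.$$
   Context: $\|K\|$ denotes the spectral norm (largest singular value) of $K$. A block matrix $S=\left[\begin{smallmatrix}A&-AK\\ K^*A&D\end{smallmatrix}\right]\in\mathbb{C}^{(n+m)\times(n+m)}$ is called a $J$-frame matrix if $A\in\mathbb{C}^{n\times n}$ is positive definite, $K\in\mathbb{C}^{n\times m}$ is strictly contractive (i.e. $\|K\|<1$), and $D\in\mathbb{C}^{m\times m}$ is a Hermitian matrix such that $D+K^*AK$ is positive definite. *)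

(* Defs.v *)
From HB Require Import structures.
From mathcomp Require Import all_boot all_order all_algebra.
From mathcomp Require Import reals complex.

Set Implicit Arguments.
Unset Strict Implicit.
Unset Printing Implicit Defensive.

Import Order.TTheory GRing.Theory Num.Theory.

Local Open Scope ring_scope.
Local Open Scope complex_scope.
Local Open Scope sesquilinear_scope.

Definition posdefmx (R : realType) (n : nat) (A : 'M[R[i]]_n) : Prop :=
  A \is hermsymmx /\
  forall x : 'cV[R[i]]_n, x != 0 -> 0 < (x^t* *m A *m x) 0 0.

(* [K^t* *m K] is Hermitian, so [spectral_diag] lists its eigenvalues with
   multiplicity; they are nonnegative reals.  There are as many as columns of
   [K]: when [n < m], the surplus ones are zero. *)
Definition singular_values (R : realType) (n m : nat) (K : 'M[R[i]]_(n, m)) :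
    'rV[R]_m :=
  \row_j Num.sqrt (complex.Re (spectral_diag (K^t* *m K) 0 j)).

(* The default value [0] only matters when [m = 0]. *)
Definition spectral_norm (R : realType) (n m : nat) (K : 'M[R[i]]_(n, m)) : R :=
  \big[Num.max/0]_(j < m) singular_values K 0 j.

Definition jframe_block (R : realType) (n m : nat)
    (A : 'M[R[i]]_n) (K : 'M[R[i]]_(n, m)) (D : 'M[R[i]]_m) : 'M[R[i]]_(n + m) :=
  block_mx A (- (A *m K)) (K^t* *m A) D.

Definition is_jframe (R : realType) (n m : nat) (S : 'M[R[i]]_(n + m)) : Prop :=
  exists (A : 'M[R[i]]_n) (K : 'M[R[i]]_(n, m)) (D : 'M[R[i]]_m),
    [/\ S = jframe_block A K D,
        posdefmx A,
        spectral_norm K < 1,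
        D \is hermsymmx &
        posdefmx (D + K^t* *m A *m K)].

(* [s] lists the eigenvalues of [A], counted with algebraic multiplicity. *)
Definition real_spectrum (R : realType) (n : nat) (A : 'M[R[i]]_n)
    (s : seq R) : Prop :=
  char_poly A = \prod_(x <- s) ('X - (x%:C)%:P).

(* Main.v *)
Require Import Defs.
From HB Require Import structures.
From mathcomp Require Import all_boot all_order all_algebra.
From mathcomp Require Import perm reals complex ring lra.

Set Implicit Arguments.
Unset Strict Implicit.
Unset Printing Implicit Defensive.

Import Order.TTheory GRing.Theory Num.Theory.

Local Open Scope ring_scope.
Local Open Scope complex_scope.
Local Open Scope sesquilinear_scope.

(** Writing [D + K^* A K > 0] and [|K| < 1] as positivity of two Hermitian
    forms makes the problem invariant under unitary changes of basis: the norm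
    condition is [1 - K^* K > 0] ([spectral_norm_lt1]).  Diagonalize
    [A = U^* diag(lam) U] and [D = V^* diag(mu) V] with the eigenvalues in the
    prescribed order ([hermitian_diagonalization]).  Then [K = U^* M V] puts the
    admissible [K] in bijection with the [M] such that [1 - M^* M > 0] and
    [diag(mu) + M^* diag(lam) M > 0], so [A] and [D] may be taken diagonal.

    Necessity ([eigenvalue_sum_gt0]) is a min-max argument.  Fix [i], counting
    from 0.  The vectors [y] supported on the first [i + 1] coordinates form a
    space of dimension [i + 1], so one of them, nonzero, satisfies the [i]
    linear conditions that the first [i] coordinates of [M y] vanish
    ([exists_flag_vector]).  For this [y] the form of [diag(mu)] is at most [mu_i |y|^2] and that of [diag(lam)]
    at [M y] is at most [lam_i |M y|^2 <= lam_i |y|^2], whence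
    [0 < (lam_i + mu_i) |y|^2].  With the convention [lam_i = 0] for [i >= n]
    this includes [r <= n]: there [M y = 0], which would force [0 < mu_i].

    Sufficiency ([exists_diagonal_contraction]) is by a rectangular diagonal
    [M], with entries [s_i] such that [- mu_i / lam_i < s_i^2 < 1] for [i < r]
    and zero otherwise; both forms are then diagonal. *)

(** * Adjoints, characteristic polynomials and quadratic forms *)

Lemma adjmxM (C : numClosedFieldType) m n p (A : 'M[C]_(m, n))
  (B : 'M[C]_(n, p)) : (A *m B)^t* = B^t* *m A^t*.
Proof. by rewrite trmx_mul map_mxM. Qed.

Lemma hermsymmxE (C : numClosedFieldType) n (H : 'M[C]_n) :
  (H \is hermsymmx) = (H == H^t*).
Proof. by rewrite qualifE /= expr0 scale1r. Qed.

Lemma char_poly_conj (F : comUnitRingType) n (P A : 'M[F]_n) :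
  P \in unitmx -> char_poly (invmx P *m A *m P) = char_poly A.
Proof.
move=> Pu; rewrite /char_poly.
have -> : char_poly_mx (invmx P *m A *m P) =
    map_mx polyC (invmx P) *m char_poly_mx A *m map_mx polyC P.
  rewrite /char_poly_mx mulmxBr mulmxBl !map_mxM; congr (_ - _).
  by rewrite scalar_mxC -mulmxA -map_mxM mulVmx // map_scalar_mx mulmx1.
by rewrite !det_mulmx mulrAC -det_mulmx -map_mxM mulVmx // map_scalar_mx
  det1 mul1r.
Qed.

Definition sqnorm (C : numClosedFieldType) n (x : 'cV[C]_n) : C :=
  \sum_j `|x j 0| ^+ 2.

Lemma sqnorm_ge0 (C : numClosedFieldType) n (x : 'cV[C]_n) : 0 <= sqnorm x.
Proof. by apply: sumr_ge0 => j _; rewrite exprn_ge0. Qed.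

Lemma qform_diag (C : numClosedFieldType) n (d : 'rV[C]_n) (x : 'cV[C]_n) :
  (x^t* *m diag_mx d *m x) 0 0 = \sum_j d 0 j * `|x j 0| ^+ 2.
Proof.
rewrite mxE; apply: eq_bigr => j _.
by rewrite mul_mx_diag !mxE normCK mulrAC mulrC [x j 0 * _]mulrC.
Qed.

Lemma qform_gram (C : numClosedFieldType) n m (M : 'M[C]_(n, m)) (H : 'M_n)
  (x : 'cV[C]_m) :
  x^t* *m (M^t* *m H *m M) *m x = (M *m x)^t* *m H *m (M *m x).
Proof. by rewrite adjmxM !mulmxA. Qed.

Lemma qform1 (C : numClosedFieldType) n (x : 'cV[C]_n) :
  (x^t* *m 1%:M *m x) 0 0 = sqnorm x.
Proof.
rewrite -diag_const_mx qform_diag; apply: eq_bigr => j _.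
by rewrite mxE mul1r.
Qed.

(** The index [i] as a dimension count: [i] homogeneous conditions on [i + 1]
    unknowns.  Both the conditions and the support constraint are columns of
    one square matrix [B]; column [i] is left free, so it is zero and [B] is
    singular. *)
Lemma exists_flag_vector (F : fieldType) n m (M : 'M[F]_(n, m)) (i : 'I_m) :
  exists y : 'cV[F]_m, [/\ y != 0, forall j : 'I_m, (i < j)%N -> y j 0 = 0 &
    forall k : 'I_n, (k < i)%N -> (M *m y) k 0 = 0].
Proof.
(* When [i > n], the indices [c] with [n <= c < i] name no row of [M], and
   the default [0] makes the corresponding condition vacuous. *)
pose B : 'M[F]_m := \matrix_(j, c)
  if (c < i)%N then oapp (M^~ j) 0 (insub (c : nat))
  else if c == i then 0 else (j == c)%:R.
have /eqP/det0P[v v0 vB] : \det B = 0.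
  rewrite (expand_det_col B i) big1 // => j _.
  by rewrite mxE ltnn eqxx mul0r.
have {}vB c : \sum_j v 0 j * B j c = 0.
  by have := congr1 (fun N : 'rV_m => N 0 c) vB; rewrite !mxE.
exists v^T; split; first by rewrite -(inj_eq trmx_inj) trmxK trmx0.
  move=> j ij; rewrite mxE -[RHS](vB j) (bigD1 j) //= big1 => [|k kj].
    by rewrite addr0 mxE ltnNge ltnW //= gt_eqF // eqxx mulr1.
  by rewrite mxE ltnNge ltnW //= gt_eqF // (negPf kj) mulr0.
move=> k ki; have km := ltn_trans ki (ltn_ord i).
rewrite mxE -[RHS](vB (Ordinal km)); apply: eq_bigr => j _.
by rewrite !mxE /= ki (insubT (fun x => x < n)%N (ltn_ord k)) /= mulrC;
  congr (_ * M _ _); apply: val_inj.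
Qed.

(** * Positive definiteness and the spectral norm *)

Section PosDef.
Variable R : realType.
Local Notation C := R[i].

Lemma posdefmx_congr n (P H : 'M[C]_n) : P \in unitmx ->
  posdefmx H -> posdefmx (P^t* *m H *m P).
Proof.
move=> Pu [Hh Hp]; split.
  move: Hh; rewrite !hermsymmxE !adjmxM trmxCK mulmxA => /eqP <-.
  exact: eqxx.
move=> x x0; rewrite qform_gram; apply: Hp.
by apply: contraNneq x0 => /(congr1 (mulmx (invmx P))); rewrite mulmx0 mulKmx // => ->.
Qed.

Lemma posdefmx_unitary n (P H : 'M[C]_n) : P \is unitarymx ->
  posdefmx (P^t* *m H *m P) <-> posdefmx H.
Proof.
move=> Pu; split; last by apply: posdefmx_congr; apply: unitarymx_unit.
move=> /(@posdefmx_congr _ (P^t*)); rewrite trmxCK !mulmxA.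
rewrite (unitarymxP Pu) mul1mx -mulmxA (unitarymxP Pu) mulmx1; apply.
by apply: unitarymx_unit; rewrite trmxC_unitary.
Qed.

Lemma posdefmx_diag n (d : 'rV[C]_n) :
  posdefmx (diag_mx d) <-> forall j, 0 < d 0 j.
Proof.
split=> [[_ Hp] j|dp].
  have := Hp (delta_mx j 0); rewrite qform_diag (bigD1 j) //= big1 => [|k kj].
    rewrite mxE !eqxx normr1 expr1n mulr1 addr0; apply.
    by apply/eqP => /matrixP /(_ j 0); rewrite !mxE !eqxx => /eqP; rewrite oner_eq0.
  by rewrite mxE (negPf kj) normr0 expr0n mulr0.
split.
  rewrite hermsymmxE; apply/eqP/matrixP => i j; rewrite !mxE.
  have [->|ij] := eqVneq i j; last by rewrite !mulr0n conjC0.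
  by rewrite !mulr1n; apply/esym/CrealP/gtr0_real.
move=> x x0; rewrite qform_diag.
have [j xj] : exists j, x j 0 != 0.
  apply/existsP; apply: contraNT x0; rewrite negb_exists => /forallP x0.
  by apply/eqP/matrixP => i k; rewrite ord1 mxE; apply/eqP/negPn.
rewrite (bigD1 j) //= ltr_pwDl //; first by rewrite mulr_gt0 ?exprn_gt0 ?normr_gt0.
by apply: sumr_ge0 => k _; rewrite mulr_ge0 ?exprn_ge0 // ltW.
Qed.

(** The eigenvalues of [1 - K^* K] are [1 - d] for [d] an eigenvalue of
    [K^* K].  As [Num.sqrt] vanishes on negative numbers, [Num.sqrt d < 1] is
    equivalent to [d < 1] whatever the sign of [d]. *)
Lemma spectral_norm_lt1 n m (K : 'M[C]_(n, m)) :
  spectral_norm K < 1 <-> posdefmx (1%:M - K^t* *m K).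
Proof.
have Hh : K^t* *m K \is hermsymmx.
  by rewrite hermsymmxE adjmxM trmxCK.
set d := spectral_diag (K^t* *m K); set P := spectralmx (K^t* *m K).
have Pu : P \is unitarymx by apply: spectral_unitarymx.
have -> : 1%:M - K^t* *m K = P^t* *m diag_mx (const_mx 1 - d) *m P.
  rewrite linearB /= diag_const_mx mulmxBr mulmxBl mulmx1.
  rewrite {1}(orthomx_spectralP (hermitian_normalmx Hh)) -/P -/d.
  by rewrite -invmx_unitary // mulVmx // unitarymx_unit.
rewrite posdefmx_unitary // posdefmx_diag.
have key j : (Num.sqrt (complex.Re (d 0 j)) < 1) = (0 < (const_mx 1 - d) 0 j).
  have /mxOverP/(_ 0 j)/RRe_real dE := hermitian_spectral_diag_real Hh.
  rewrite -[X in _ < X]sqrtr1 ltr_sqrt // !mxE subr_gt0 -[X in _ = (X < _)]dE.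
  by rewrite -(rmorph1 (real_complex R)) ltcR.
split=> [/bigmax_ltP[_ lt1] j|pos].
  by rewrite -key; have := lt1 j isT; rewrite mxE.
by apply/bigmax_ltP; split=> // j _; rewrite mxE key.
Qed.

(** * Rectangular diagonal matrices and ordered diagonalization *)

(** One sequence indexed by [nat] serves every format, so that products of
    matrices of different formats stay pointwise products of sequences and the
    zero default of [nth] continues a list of eigenvalues. *)
Definition rdiag_mx n m (s : nat -> R) : 'M[C]_(n, m) :=
  \matrix_(k, j) ((s k)%:C *+ (k == j :> nat)).

Lemma adj_rdiag_mx n m s : (rdiag_mx n m s)^t* = rdiag_mx m n s.
Proof.
apply/matrixP => i j; rewrite !mxE eq_sym rmorphMn /=.
by case: eqP => // ->; congr (_ *+ _); apply/CrealP; rewrite complex_real.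
Qed.

(** The inner dimension [p] cuts off the entries of index [k >= p], hence the
    condition on those entries. *)
Lemma mul_rdiag_mx n p m s t : (forall k, (p <= k)%N -> s k * t k = 0) ->
  rdiag_mx n p s *m rdiag_mx p m t = rdiag_mx n m (fun k => s k * t k).
Proof.
move=> st0; apply/matrixP => i j; rewrite !mxE.
have [ip|pi] := ltnP i p.
  rewrite (bigD1 (Ordinal ip)) //= big1 => [|k kj].
    by rewrite !mxE eqxx mulr1n mulrnAr addr0 -rmorphM.
  rewrite !mxE (_ : (i == k :> nat) = false) ?mul0r //.
  by apply: contraNF kj => /eqP ik; apply/eqP/val_inj; rewrite /= ik.
rewrite st0 // mul0rn big1 // => k _; rewrite !mxE.
by rewrite gtn_eqF ?mul0r // (leq_trans _ pi).
Qed.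

Lemma rdiag_mx_diag n s : rdiag_mx n n s = diag_mx (\row_j (s j)%:C).
Proof. by apply/matrixP => i j; rewrite !mxE. Qed.

Lemma rdiag_mx1 n : rdiag_mx n n (fun=> 1) = 1%:M.
Proof. by apply/matrixP => i j; rewrite !mxE rmorph1. Qed.

Lemma rdiag_mxD n m s t :
  rdiag_mx n m s + rdiag_mx n m t = rdiag_mx n m (fun k => s k + t k).
Proof. by apply/matrixP => i j; rewrite !mxE -mulrnDl -rmorphD. Qed.

Lemma rdiag_mxB n m s t :
  rdiag_mx n m s - rdiag_mx n m t = rdiag_mx n m (fun k => s k - t k).
Proof. by apply/matrixP => i j; rewrite !mxE -mulrnBl -rmorphB. Qed.

Lemma qform_rdiag n s (x : 'cV[C]_n) :
  (x^t* *m rdiag_mx n n s *m x) 0 0 = \sum_(j < n) (s j)%:C * `|x j 0| ^+ 2.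
Proof.
by rewrite rdiag_mx_diag qform_diag; apply: eq_bigr => j _; rewrite mxE.
Qed.

Lemma posdef_rdiag n s :
  posdefmx (rdiag_mx n n s) <-> forall j, (j < n)%N -> 0 < s j.
Proof.
rewrite rdiag_mx_diag posdefmx_diag; split=> [H j jn|H j].
  by have := H (Ordinal jn); rewrite mxE ltcR.
by rewrite mxE ltcR H.
Qed.

(** The spectral theorem gives the eigenvalues in an unspecified order;
    comparing the roots of the characteristic polynomial shows that it differs
    from [s] by a permutation, which is absorbed in the unitary matrix. *)
Lemma hermitian_diagonalization n (H : 'M[C]_n) (s : n.-tuple R) :
  H \is hermsymmx -> real_spectrum H s ->
  exists2 U : 'M[C]_n, U \is unitarymx &
    H = U^t* *m rdiag_mx n n (nth 0 s) *m U.
Proof.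
move=> Hh Hs; pose P := spectralmx H; pose d := spectral_diag H.
have Pu : P \is unitarymx by apply: spectral_unitarymx.
have HE := orthomx_spectralP (hermitian_normalmx Hh); rewrite -/P -/d in HE.
have : perm_eq [tuple d 0 j | j < n] [tuple of map (real_complex R) s].
  apply: prod_XsubC_eq; rewrite !big_map -Hs HE char_poly_conj ?unitarymx_unit //.
  rewrite char_poly_trig ?diag_mx_is_trig // [index_enum _]unlock.
  by apply: eq_bigr => j _; rewrite mxE eqxx.
rewrite perm_sym => /tuple_permP[p /val_inj sE].
have {}sE (j : 'I_n) : (s`_j)%:C = d 0 (p j).
  have := congr1 ((@tnth _ _)^~ j) sE.
  by rewrite /= tnth_map !tnth_mktuple (tnth_nth 0).
pose Q : 'M[C]_n := perm_mx p.
have QE : Q^t* = perm_mx p^-1 by rewrite tr_perm_mx map_perm_mx.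
have QK : Q^t* *m Q = 1%:M by rewrite QE -perm_mxM mulVg perm_mx1.
have -> : rdiag_mx n n (nth 0 s) = Q *m diag_mx d *m Q^t*.
  rewrite QE -row_permE -col_permE; apply/matrixP => i j.
  by rewrite !mxE sE (inj_eq perm_inj).
have Qu : Q \is unitarymx.
  by apply/unitarymxP; rewrite QE -perm_mxM mulgV perm_mx1.
exists (Q *m P); first exact: mul_unitarymx Qu Pu.
rewrite adjmxM !mulmxA -[_ *m Q^t* *m Q]mulmxA QK mulmx1.
by rewrite -[_ *m Q^t* *m Q]mulmxA QK mulmx1 HE invmx_unitary.
Qed.

(** * The two implications for diagonal matrices *)

(** Necessity.  The monotonicity hypotheses are those of eigenvalue lists
    continued by zero, so the lemma also covers [i >= n], where
    [lam i = 0]. *)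
Lemma eigenvalue_sum_gt0 n m (lam mu : nat -> R) (M : 'M[C]_(n, m)) i :
  (i < m)%N -> 0 <= lam i ->
  (forall k, (i <= k < n)%N -> lam k <= lam i) ->
  (forall j, (j <= i)%N -> mu j <= mu i) ->
  posdefmx (1%:M - M^t* *m M) ->
  posdefmx (rdiag_mx m m mu + M^t* *m rdiag_mx n n lam *m M) ->
  0 < lam i + mu i.
Proof.
move=> im lam_ge0 lam_le mu_le [_ contrM] [_ posM].
have [y [y0 y_supp My_supp]] := exists_flag_vector M (Ordinal im).
have ltM : sqnorm (M *m y) < sqnorm y.
  have := contrM y y0; rewrite mulmxBr mulmxBl mxE qform1 [X in _ + X]mxE.
  by rewrite -[M^t*]mulmx1 qform_gram qform1 subr_gt0.
have := posM y y0; rewrite mulmxDr mulmxDl mxE qform_gram !qform_rdiag => pos.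
have y_gt0 : 0 < sqnorm y := le_lt_trans (sqnorm_ge0 _) ltM.
rewrite -ltcR rmorphD /= -(pmulr_lgt0 _ y_gt0) mulrDl addrC.
apply: lt_le_trans pos _; apply: lerD; last first.
  apply: (@le_trans _ _ ((lam i)%:C * sqnorm (M *m y))); last first.
    by rewrite ler_wpM2l ?ler0c // ltW.
  rewrite mulr_sumr ler_sum // => k _; have [ki|ik] := ltnP k i.
    by rewrite My_supp // normr0 expr0n !mulr0.
  by rewrite ler_wpM2r ?exprn_ge0 // lecR lam_le // ik /=.
(* The remaining summand is the form of [diag(mu)], with [y] supported on
   the indices up to [i]. *)
rewrite mulr_sumr ler_sum // => j _; have [ji|ij] := leqP j i.
  by rewrite ler_wpM2r ?exprn_ge0 // lecR mu_le.
by rewrite y_supp // normr0 expr0n !mulr0.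
Qed.

Lemma exists_diagonal_contraction n m r (lam mu : nat -> R) :
  (r <= n)%N ->
  (forall i, (i < r)%N -> mu i <= 0) ->
  (forall i, (i < r)%N -> 0 < lam i + mu i) ->
  (forall i, (r <= i < m)%N -> 0 < mu i) ->
  exists M : 'M[C]_(n, m), posdefmx (1%:M - M^t* *m M) /\
    posdefmx (rdiag_mx m m mu + M^t* *m rdiag_mx n n lam *m M).
Proof.
move=> rn mu_le0 sum_gt0 mu_gt0.
(* [s i ^+ 2] is the midpoint of the admissible interval between
   [- mu i / lam i] and [1]. *)
pose s i := if (i < r)%N then Num.sqrt ((1 - mu i / lam i) / 2) else 0.
have lam_gt0 i : (i < r)%N -> 0 < lam i.
  by move=> ir; have := sum_gt0 i ir; have := mu_le0 i ir; lra.
have sE i : (i < r)%N -> s i * s i = (1 - mu i / lam i) / 2.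
  move=> ir; rewrite /s ir -expr2 sqr_sqrtr //.
  have : mu i / lam i <= 0 by rewrite pmulr_lle0 ?invr_gt0 ?lam_gt0 ?mu_le0.
  by lra.
have s0 i : (r <= i)%N -> s i = 0 by rewrite /s ltnNge => ->.
have s0n i : (n <= i)%N -> s i = 0 by move=> /(leq_trans rn)/s0.
exists (rdiag_mx n m s).
rewrite adj_rdiag_mx !mul_rdiag_mx => [|k /s0n ->|k /s0n ->|k /s0n ->];
  rewrite ?mul0r //.
rewrite -rdiag_mx1 rdiag_mxB rdiag_mxD !posdef_rdiag.
split=> i im; have [ir|ri] := ltnP i r.
- rewrite sE //; have : - 1 < mu i / lam i.
    by rewrite ltr_pdivlMr ?lam_gt0 //; have := sum_gt0 i ir; lra.
  by lra.
- by rewrite s0 // mulr0 subr0.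
- rewrite mulrAC sE //.
  have lam_neq0 : lam i != 0 by rewrite gt_eqF ?lam_gt0.
  have -> : mu i + (1 - mu i / lam i) / 2 * lam i = (lam i + mu i) / 2 by field.
  by rewrite divr_gt0 ?sum_gt0.
- by rewrite s0 // mulr0 addr0 mu_gt0 // ri.
Qed.

End PosDef.

(** * Reduction to the diagonal case *)

Theorem theorem5p3 (R : realType) (n m r : nat)
  (A : 'M[R[i]]_n) (D : 'M[R[i]]_m) (lam : n.-tuple R) (mu : m.-tuple R)
  (hA : posdefmx A)
  (hlamA : real_spectrum A lam)
  (hlam_sorted : sorted >=%R lam)
  (hlam_gt0 : forall i : nat, (i < n)%N -> 0 < lam`_i)
  (hD : D \is hermsymmx)
  (hmuD : real_spectrum D mu)
  (hmu_sorted : sorted <=%R mu)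
  (hrm : (r <= m)%N)
  (hmu_le0 : forall i : nat, (i < r)%N -> mu`_i <= 0)
  (hmu_gt0 : forall i : nat, (r <= i < m)%N -> 0 < mu`_i) :
  (exists K : 'M[R[i]]_(n, m),
     spectral_norm K < 1 /\ is_jframe (jframe_block A K D))
  <->
  ((r <= n)%N /\ forall i : nat, (i < r)%N -> 0 < lam`_i + mu`_i).
Proof.
have [U Uu AE] := hermitian_diagonalization hA.1 hlamA.
have [V Vu DE] := hermitian_diagonalization hD hmuD.
have UK : U *m U^t* = 1%:M by apply/unitarymxP.
have VK : V^t* *m V = 1%:M by rewrite -invmx_unitary // mulVmx ?unitarymx_unit.
pose K (M : 'M[R[i]]_(n, m)) := U^t* *m M *m V.
have gramK M : 1%:M - (K M)^t* *m K M = V^t* *m (1%:M - M^t* *m M) *m V.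
  rewrite mulmxBr mulmxBl mulmx1 VK /K !adjmxM trmxCK !mulmxA.
  by rewrite -[_ *m U *m U^t*]mulmxA UK mulmx1.
have sumK M : D + (K M)^t* *m A *m K M =
    V^t* *m (rdiag_mx m m (nth 0 mu) +
             M^t* *m rdiag_mx n n (nth 0 lam) *m M) *m V.
  rewrite mulmxDr mulmxDl -DE {1}AE /K !adjmxM trmxCK !mulmxA.
  rewrite -[_ *m U *m U^t*]mulmxA UK mulmx1.
  by rewrite -[_ *m U *m U^t*]mulmxA UK mulmx1.
(* Equality of the diagonal blocks identifies [A'] with [A] and [D'] with [D];
   the argument then runs on [K'], so [K'] is not compared with [K0]. *)
split=> [[K0 [_ [A' [K' [D' [SE _ K'lt1 _ posK']]]]]]|[rn sum_gt0]].
  have [AA' _ _ DD'] := eq_block_mx SE.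
  pose M := U *m K' *m V^t*.
  have K'E : K' = K M.
    rewrite /K /M !mulmxA -[_ *m V^t* *m V]mulmxA VK mulmx1.
    by rewrite -(invmx_unitary Uu) mulVmx ?unitarymx_unit ?mul1mx.
  move: K'lt1 posK'; rewrite spectral_norm_lt1 -AA' -DD' K'E gramK sumK.
  rewrite !posdefmx_unitary // => contrM posM.
  have sum_gt0 i : (i < r)%N -> 0 < lam`_i + mu`_i.
    move=> ir; have im := leq_trans ir hrm.
    have lam_ge0 k : 0 <= lam`_k.
      have [kn|nk] := ltnP k n; first by rewrite ltW ?hlam_gt0.
      by rewrite nth_default ?size_tuple.
    apply: (eigenvalue_sum_gt0 im (lam_ge0 i) _ _ contrM posM).
      move=> k /andP[ik kn]; have i_n := leq_ltn_trans ik kn.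
      have ge_tr : transitive (>=%R : rel R) by move=> a b c /[swap]; exact: le_trans.
      have ge_refl : reflexive (>=%R : rel R) by move=> a; exact: lexx.
      by apply: (sorted_leq_nth ge_tr ge_refl 0 hlam_sorted); rewrite ?inE ?size_tuple.
    move=> j ji; have jm := leq_ltn_trans ji im.
    by apply: (sorted_leq_nth (@le_trans _ R) (@le_refl _ R) 0 hmu_sorted);
      rewrite ?inE ?size_tuple.
  (* If [n < r], index [n] has [lam`_n = 0] and [mu`_n <= 0]. *)
  split=> //; rewrite leqNgt; apply/negP => nr.
  have := sum_gt0 n nr; rewrite nth_default ?size_tuple // add0r.
  by rewrite ltNge hmu_le0.
have [M [contrM posM]] := exists_diagonal_contraction rn hmu_le0 sum_gt0 hmu_gt0.
exists (K M).
have normK : spectral_norm (K M) < 1.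
  by rewrite spectral_norm_lt1 gramK posdefmx_unitary.
split; first exact: normK.
exists A, (K M), D; split; [exact: erefl | exact: hA | exact: normK | exact: hD |].
by rewrite sumK posdefmx_unitary.
Qed.
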